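(* Let $G$ and $K$ be countable graphs with disjoint vertex sets, where $G$ contains no alternating ray and $K$ is finite. Let $\hat G$ be any graph obtained from the disjoint union of $G$ and $K$ by adding an arbitrary set of edges, each with one endpoint in $V(G)$ and the other in $V(K)$. Let $c_K:V(K)\to\{0,1\}$ be any map. Then there is a coloring $\hat c:V(\hat G)\to\{0,1\}$ extending $c_K$ such that $\hat c$ is strongly maximal in $V(G)$ (as a coloring of $\hat G$) and $\hat c$ is unfriendly (in $\hat G$) at every vertex of $V(G)$ of infinite degree.
   Context: Graphs are simple, undirected, possibly infinite; $N(v)$ is the neighborhood, the degree of $v$ is $|N(v)|$ (since $K$ is finite, a vertex of $G$ has finite degree in $G$ iff it has finite degree in $\hat G$). A ray is a one-way infinite path $v_0v_1\dots$; it is alternating if it passes through infinitely many vertices of finite degree and infinitely many of infinite degree. A coloring of a graph $\Gamma$ is a map $c:V(\Gamma)\to\{0,1\}$. It is unfriendly at $v$ if $|\{u\in N(v):c(u)\neq c(v)\}|\ge|\{u\in N(v):c(u)=c(v)\}|$. Let $\mathit{trans}(c)=\{uv\in E(\Gamma):c(u)\neq c(v)\}$; for $F\subseteq V(\Gamma)$ let $c*F$ be the coloring that differs from $c$ exactly on $F$; for a finite set $F$ of vertices of finite degree, $\mathit{dtrans}(c,F)=|\mathit{trans}(c)\setminus\mathit{trans}(c*F)|-|\mathit{trans}(c*F)\setminus\mathit{trans}(c)|$. The coloring $c$ is strongly maximal in $A\subseteq V(\Gamma)$ if $\mathit{dtrans}(c,F)\ge 0$ for every finite set $F\subseteq A$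 consisting of vertices of finite degree. *)

(* Defs.v *)
From HB Require Import structures.
From mathcomp Require Import all_boot.
From mathcomp Require Import finmap.
From Stdlib Require Import ZArith.

Set Implicit Arguments.
Unset Strict Implicit.
Unset Printing Implicit Defensive.

Local Open Scope fset_scope.

Definition simple_graph (T : Type) (adj : T -> T -> Prop) : Prop :=
  (forall x y, adj x y -> adj y x) /\ (forall x, ~ adj x x).

Definition hat_adj (VG VK : Type) (adjG : VG -> VG -> Prop)
  (adjK : VK -> VK -> Prop) (cross : VG -> VK -> Prop) :
  VG + VK -> VG + VK -> Prop :=
  fun x y => match x, y with
  | inl a, inl b => adjG a b
  | inr a, inr b => adjK a b
  | inl a, inr k => cross a k
  | inr k, inl a => cross a k
  end.

Definition finite_degree (T : Type) (adj : T -> T -> Prop) (v : T) : Prop :=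
  exists s : seq T, forall u, adj v u -> List.In u s.

Definition alternating_ray (T : Type) (adj : T -> T -> Prop) (r : nat -> T) : Prop :=
  (forall m n, r m = r n -> m = n) /\
  (forall n, adj (r n) (r n.+1)) /\
  (forall m, exists n, (m <= n)%N /\ finite_degree adj (r n)) /\
  (forall m, exists n, (m <= n)%N /\ ~ finite_degree adj (r n)).

Definition card_le (T : Type) (B A : T -> Prop) : Prop :=
  exists f : T -> T, (forall x, B x -> A (f x)) /\
    (forall x y, B x -> B y -> f x = f y -> x = y).

Definition unfriendly_at (T : Type) (adj : T -> T -> Prop) (c : T -> bool) (v : T) : Prop :=
  card_le (fun u => adj v u /\ c u = c v) (fun u => adj v u /\ c u <> c v).

Definition has_card (T : eqType) (P : T -> Prop) (n : nat) : Prop :=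
  exists s : seq T, uniq s /\ size s = n /\ forall x, P x <-> x \in s.

(* Unordered edges are 2-element finite sets {u, v}. trans c = edges whose
   endpoints get different colours. *)
Definition trans (T : choiceType) (adj : T -> T -> Prop) (c : T -> bool)
  (e : {fset T}) : Prop :=
  exists u v, e = [fset u; v] /\ adj u v /\ c u <> c v.

Definition flip (T : eqType) (c : T -> bool) (F : seq T) : T -> bool :=
  fun x => if x \in F then ~~ c x else c x.

Definition dtrans (T : choiceType) (adj : T -> T -> Prop) (c : T -> bool)
  (F : seq T) (d : Z) : Prop :=
  exists a b : nat,
    has_card (fun e => trans adj c e /\ ~ trans adj (flip c F) e) a /\
    has_card (fun e => trans adj (flip c F) e /\ ~ trans adj c e) b /\
    d = (Z.of_nat a - Z.of_nat b)%Z.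

Definition strongly_maximal_in (T : choiceType) (adj : T -> T -> Prop)
  (c : T -> bool) (A : T -> Prop) : Prop :=
  forall F : seq T, (forall x, x \in F -> A x /\ finite_degree adj x) ->
    exists d, dtrans adj c F d /\ (0 <= d)%Z.

(* Main.v *)
Require Import Defs.
From Stdlib Require Import ZArith.
From HB Require Import structures.
From mathcomp Require Import finmap.
From mathcomp Require Import all_boot.
From mathcomp Require classical_sets.
From mathcomp Require Import boolp zify.

Set Implicit Arguments.
Unset Strict Implicit.
Unset Printing Implicit Defensive.
Set Bullet Behavior "Strict Subproofs".

(** Call a set [W] of vertices good if every colouring of its complement extends
    to [W] so that the result is strongly maximal in [W] and every vertex of [W]
    of infinite degree has infinitely many neighbours of the opposite colour,
    and hereditarily good if all its subsets are good.

    Changing a colouring along finitely many edges of finite-degree vertices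
    lowers the optimum by a bounded amount, so finitely many flips restore strong
    maximality.  In particular a vertex of infinite degree can be added to a good
    set: if it is unhappy, flip it, which hurts along finitely many edges only.

    A set whose components are all hereditarily good is hereditarily good.  So if
    the vertices of [G] are not hereditarily good, some component is bad.  Delete
    a vertex [v] of it and step to a neighbour of [v] in a bad component of what
    remains.  Iterating produces a ray, which is alternating if vertices of both
    kinds always remain reachable.  Otherwise, from some point on, all reachable
    vertices have the same kind.  The bad component is then covered by the
    reachable vertices and by hereditarily good blocks, the neighbourhood of each
    block being a finite set of reachable vertices, and is hereditarily good
    after all.  If the reachable vertices have finite degree, each block
    interacts with the rest along finitely many edges and a compactness argument
    applies.  If they have infinite degree, the blocks are coloured one after the
    other, and strong maximality is repaired by finitely many flips per block. *)

(** * Eventual properties of natural numbers *)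

Definition eventually (P : nat -> Prop) := exists N, forall n, N <= n -> P n.

Lemma eventually_and P Q :
  eventually P -> eventually Q -> eventually (fun n => P n /\ Q n).
Proof.
move=> [N hN] [M hM]; exists (maxn N M) => n; rewrite geq_max => /andP[h1 h2].
by split; [apply: hN | apply: hM].
Qed.

Lemma eventually_mono (P Q : nat -> Prop) :
  (forall n, P n -> Q n) -> eventually P -> eventually Q.
Proof. by move=> PQ [N hN]; exists N => n /hN /PQ. Qed.

Lemma eventually_all (P : nat -> Prop) : (forall n, P n) -> eventually P.
Proof. by move=> h; exists 0. Qed.

Lemma InP (T : eqType) (x : T) s : reflect (List.In x s) (x \in s).
Proof.
elim: s => [|y s IH] /=; first by constructor.
rewrite inE; apply: (iffP orP) => [[/eqP->|/IH]|[->|/IH]]; auto.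
Qed.

(** * Walks alternating between two kinds of states *)

Section AlternatingWalk.
Variables (T : Type) (stp : T -> T -> Prop) (K : T -> bool) (Inv : T -> Prop).

Fixpoint steps n p q := if n is m.+1 then exists2 r, stp p r & steps m r q else p = q.

Lemma steps_rcons n p q r : steps n p q -> stp q r -> steps n.+1 p r.
Proof.
elim: n p => [p -> qr|n IH p [p' pp' /IH h] qr]; first by exists r.
by exists p' => //; apply: h.
Qed.

Hypothesis InvS : forall p q, Inv p -> stp p q -> Inv q.
Hypothesis reach : forall p, Inv p -> forall t, exists n q, steps n p q /\ K q = t.

(** The walk always takes the first step of a shortest path to a state of the other kind. The
    distance drops with each step, so that kind is hit after finitely many. *)
Lemma alternating_walk p0 : Inv p0 -> exists f : nat -> T,
  [/\ f 0 = p0, forall n, stp (f n) (f n.+1) &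
      forall t m, exists2 n, m <= n & K (f n) = t].
Proof.
move=> I0; pose near t n p := exists2 q, steps n p q & K q = t.
have /choice[nx hnx] (pt : T * bool) : exists q, Inv pt.1 -> K pt.1 <> pt.2 ->
    stp pt.1 q /\ forall n, near pt.2 n pt.1 -> exists2 m, m < n & near pt.2 m q.
  case: pt => p t /=; case: (pselect (Inv p /\ K p <> t)) => [[Ip Kp]|h]; last first.
    by exists p => Ip Kp; case: h.
  have ex : exists n, `[< near t n p >].
    by have [n [q [pq Kq]]] := reach Ip t; exists n; apply/asboolP; exists q.
  case: (ex_minnP ex) => -[|n] /asboolP[q].
    by move=> /= <-.
  move=> /= [r pr rq] Kq nmin; exists r => _ _; split=> // m hm.
  by exists n; [apply: nmin; apply/asboolP | exists q].
pose tgt (pt : T * bool) := if K pt.1 == pt.2 then ~~ pt.2 else pt.2.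
pose st := fix st n := if n is m.+1 then (nx ((st m).1, tgt (st m)), tgt (st m)) else (p0, true).
have Ktgt pt : K pt.1 <> tgt pt.
  by rewrite /tgt; case: eqP => // ->; case: pt.2.
have If n : Inv (st n).1.
  elim: n => // n IH; have [h _] := hnx ((st n).1, tgt (st n)) IH (@Ktgt (st n)).
  exact: InvS IH h.
have stpS n := hnx ((st n).1, tgt (st n)) (If n) (@Ktgt (st n)).
have hit k n : near (tgt (st n)) k (st n).1 -> exists2 m, n <= m & K (st m).1 = tgt (st n).
  elim/ltn_ind: k n => k IH n hk; have [_ /(_ _ hk)[k' k'k nk']] := stpS n.
  case: (pselect (K (st n.+1).1 = tgt (st n))) => [h|h]; first by exists n.+1.
  have tE : tgt (st n.+1) = tgt (st n) by rewrite {1}/tgt; case: eqP.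
  have [|m nm Km] := IH k' k'k n.+1; first by rewrite tE.
  by exists m; [apply: ltnW | rewrite Km].
exists (fun n => (st n).1); split=> // [n|t m]; first by have [] := stpS n.
case: (pselect (K (st m).1 = t)) => [h|h]; first by exists m.
have [k [q [mq Kq]]] := reach (If m) (tgt (st m)).
have [|n mn Kn] := hit k m; first by exists q.
exists n => //; rewrite Kn; move: h (@Ktgt (st m)).
by case: (K _) (tgt _) t => [] [] [].
Qed.

End AlternatingWalk.

Section Graph.
Variables (V : countType) (adj : V -> V -> Prop).
Hypothesis adj_sym : forall x y, adj x y -> adj y x.
Implicit Types (x y z u v : V) (F s : seq V) (a b c d : V -> bool).
Implicit Types (A C P Q W Y : V -> Prop).

(** * Counting cut edges *)

Definition infinite P := forall s : seq V, exists2 x, P x & x \notin s.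

Lemma infinite_sub P Q (s : seq V) :
  infinite P -> (forall x, P x -> Q x \/ x \in s) -> infinite Q.
Proof.
move=> iP PQ t; have [x Px] := iP (t ++ s).
rewrite mem_cat negb_or => /andP[xt xs]; exists x => //.
by case: (PQ _ Px) => // xs'; rewrite xs' in xs.
Qed.

Lemma infinitePn P : ~ infinite P <-> exists s : seq V, forall x, P x -> x \in s.
Proof.
split=> [nP|[s hs] /(_ s)[x /hs ->//]].
apply: contrapT => h; apply: nP => s; apply: contrapT => h2; apply: h.
exists s => x Px; apply: contrapT => /negP xs; apply: h2; by exists x.
Qed.


Definition verts n : seq V := pmap (@pickle_inv V) (iota 0 n).

Lemma mem_verts n x : (x \in verts n) = (pickle x < n).
Proof.
rewrite mem_pmap; apply/mapP/idP => [[i]|xn].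
  by rewrite mem_iota add0n => /= lin /esym xi; have := @pickle_invK V i; rewrite xi /= => ->.
by exists (pickle x); rewrite ?mem_iota ?pickleK_inv.
Qed.

Lemma uniq_verts n : uniq (verts n).
Proof.
apply: (@pmap_uniq _ _ _ pickle); last exact: iota_uniq.
exact: pickle_invK.
Qed.

Lemma verts_sub (s : seq V) : exists N, forall n, N <= n -> {subset s <= verts n}.
Proof.
elim: s => [|x s [N IH]]; first by exists 0.
exists (maxn N (pickle x).+1) => n; rewrite geq_max => /andP[/IH h1 h2] y.
by rewrite inE => /orP[/eqP->|/h1//]; rewrite mem_verts.
Qed.

Definition fin x := finite_degree adj x.

Lemma nbrs_ex x : exists s : seq V, fin x -> forall y, adj x y -> y \in s.
Proof.
case: (pselect (fin x)) => [[s hs]|h]; last by exists [::] => /h.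
by exists s => _ y /hs /InP.
Qed.

Definition nbrs x : seq V := projT1 (cid (nbrs_ex x)).

Lemma nbrsP x y : fin x -> adj x y -> y \in nbrs x.
Proof. by rewrite /nbrs; case: cid => s /= hs /hs; apply. Qed.

Lemma infinite_degree x : ~ fin x -> infinite (adj x).
Proof.
move=> nf; apply: contrapT => /infinitePn[s hs]; apply: nf; exists s => u /hs.
by move/InP.
Qed.

Definition edges n : seq (V * V) :=
  [seq p <- [seq (x, y) | x <- verts n, y <- verts n] |
     `[< adj p.1 p.2 >] && (pickle p.1 < pickle p.2)].

Lemma mem_edges n x y : ((x, y) \in edges n) =
  [&& `[< adj x y >], pickle x < pickle y & pickle y < n].
Proof.
rewrite mem_filter /= -andbA; case: asboolP => //= _.
case: ltnP => //= xy; apply/allpairsPdep/idP => [[x' [y' [_ yn [_ yE]]]]|yn].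
  by rewrite yE -mem_verts.
by exists x, y; rewrite !mem_verts yn (ltn_trans xy yn).
Qed.

Lemma uniq_edges n : uniq (edges n).
Proof.
apply: filter_uniq; apply: allpairs_uniq; rewrite ?uniq_verts //.
by move=> [x y] [x' y'].
Qed.

(** The whole cut may be infinite, so colourings are compared through the cuts among the first [n]
    vertices, for all large [n]. *)
Definition cut n c := \sum_(p <- edges n) (c p.1 != c p.2 : nat).

(** The comparison is made edge by edge; a listed edge may violate it by two, whence the
    doubling. *)
Lemma cut_le4 c1 c2 c3 c4 (B : seq (V * V)) n :
  (forall x y, adj x y ->
     (c1 x != c1 y) + (c2 x != c2 y) <=
     (c3 x != c3 y) + (c4 x != c4 y) + ((x, y) \in B).*2) ->
  cut n c1 + cut n c2 <= cut n c3 + cut n c4 + (size B).*2.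
Proof.
move=> h; rewrite /cut -!big_split /=.
have -> : (size B).*2 = 2 * size B by rewrite mul2n.
have lB : \sum_(p <- edges n) (p \in B : nat) <= size B.
  rewrite -big_mkcond sum1_count -size_filter.
  apply: uniq_leq_size; first by rewrite filter_uniq // uniq_edges.
  by move=> p; rewrite mem_filter => /andP[].
apply: leq_trans (_ : _ <= \sum_(p <- edges n) ((c3 p.1 != c3 p.2) + (c4 p.1 != c4 p.2) + (p \in B) .*2)) _.
  rewrite big_seq [X in _ <= X]big_seq; apply: leq_sum => -[x y].
  by rewrite mem_edges /= => /andP[/asboolP/h].
rewrite big_split /= leq_add2l.
under eq_bigr do rewrite -mul2n.
by rewrite -big_distrr /= leq_mul2l.
Qed.

(* [W] only constrains where the two colourings may differ; the finite degree
   of these vertices makes the difference of the cuts eventually constant. *)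
Definition findiff (W : V -> Prop) c d :=
  exists F : seq V, (forall x, x \in F -> W x /\ fin x) /\
    forall x, x \notin F -> c x = d x.

Lemma findiff_refl W c : findiff W c c.
Proof. by exists [::]. Qed.

Lemma findiff_sym W c d : findiff W c d -> findiff W d c.
Proof. by move=> [F [h1 h2]]; exists F; split=> // x /h2. Qed.

Lemma findiff_trans W c d e : findiff W c d -> findiff W d e -> findiff W c e.
Proof.
move=> [F [h1 h2]] [G [h3 h4]]; exists (F ++ G); split=> x.
  by rewrite mem_cat => /orP[/h1|/h3].
by rewrite mem_cat => /norP[/h2-> /h4].
Qed.

Lemma findiff_sub (W W' : V -> Prop) c d :
  (forall x, W x -> fin x -> W' x) -> findiff W c d -> findiff W' c d.
Proof.
move=> s [F [h1 h2]]; exists F; split=> // x /h1[? ?]; split; auto.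
Qed.

Lemma findiff_out W c d x : findiff W c d -> ~ (W x /\ fin x) -> c x = d x.
Proof. by move=> [F [h1 h2]] nx; apply: h2; apply/negP => /h1. Qed.

(** The cuts differ only along edges that meet the finite set [F]. All of these have appeared once
    [n] passes [F] and its neighbours, and from then on the difference is constant. *)
Lemma cut_dichotomy W c d : findiff W c d ->
  eventually (fun n => cut n c <= cut n d) \/
  eventually (fun n => cut n d < cut n c).
Proof.
move=> [F [h1 h2]].
pose tF (p : V * V) := (p.1 \in F) || (p.2 \in F).
have [N hN] := verts_sub (F ++ flatten (map nbrs F)).
pose cF n c := \sum_(p <- edges n | tF p) (c p.1 != c p.2 : nat).
have cE n : cut n c + cF n d = cut n d + cF n c.
  rewrite /cut (bigID tF) /= [in RHS](bigID tF) /= -/(cF n c) -/(cF n d).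
  rewrite addnAC [RHS]addnAC [cF n d + _]addnC; congr (_ + _).
  by apply: eq_bigr => p /norP[/h2-> /h2->].
have cst c' n : N <= n -> cF n c' = cF N c'.
  move=> Nn; rewrite /cF -big_filter -[RHS]big_filter; apply: perm_big.
  apply: uniq_perm; try exact/filter_uniq/uniq_edges; move=> -[x y].
  rewrite mem_filter [in RHS]mem_filter !mem_edges; case: (boolP (tF _)) => //= txy.
  case: asboolP => //= axy; case: ltnP => //= xy.
  have yN : y \in verts N.
    apply: hN => //; rewrite mem_cat; case/orP: txy => /= xF; last by rewrite xF.
    apply/orP; right; apply/flatten_mapP; exists x => //.
    by apply: nbrsP => //; have [] := h1 _ xF.
  move: yN; rewrite mem_verts => yN; by rewrite yN (leq_trans yN Nn).
case: (leqP (cF N c) (cF N d)) => h; [left|right]; exists N => n Nn;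
  have := cE n; rewrite !cst //; lia.
Qed.

Definition strong_max (W : V -> Prop) c :=
  forall d, findiff W d c -> eventually (fun n => cut n d <= cut n c).

(** Each improving recolouring lowers the gain still possible by at least one, so at most [k]
    improvements are made. *)
Lemma strong_max_repair W c k :
  (forall d, findiff W d c -> eventually (fun n => cut n d <= cut n c + k)) ->
  exists2 d, findiff W d c & strong_max W d.
Proof.
elim/ltn_ind: k c => k IH c hc.
case: (pselect (strong_max W c)) => [sm|nsm]; first by exists c => //; exact: findiff_refl.
have [d [dc nd]] : exists d, findiff W d c /\ ~ eventually (fun n => cut n d <= cut n c).
  by apply: contrapT => h; apply: nsm => d dc; apply: contrapT => h2; apply: h; exists d.
have [//|lt] := cut_dichotomy dc.
have k0 : 0 < k.
  have [N hN] := eventually_and lt (hc _ dc).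
  by have [] := hN N (leqnn _); lia.
have [||d' d'd sm] := IH k.-1 _ d; first by rewrite prednK.
  move=> d' d'd; have := eventually_and lt (hc d' (findiff_trans d'd dc)).
  apply: eventually_mono => n; lia.
by exists d' => //; apply: findiff_trans d'd dc.
Qed.

(* Moving the outside colouring from [d] to [d'] affects the gain of a
   recolouring of [W] only along the listed edges: an edge that was uncut and
   becomes cut works against recolouring. *)
Lemma strong_max_perturb W d d' (B : seq (V * V)) :
  strong_max W d -> (forall x, W x -> d' x = d x) ->
  (forall x y, W x -> fin x -> ~ W y -> adj x y -> d y <> d' y -> d x <> d y ->
     (x, y) \in B) ->
  forall c, findiff W c d' ->
    eventually (fun n => cut n c <= cut n d' + (size B).*2.*2).
Proof.
move=> sm dd' hB c cd'.
(* The recolouring of [W] is grafted onto the old outside colouring, where the maximality of [d]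
   applies. *)
pose c2 x := if `[< W x >] then c x else d x.
have c2d : findiff W c2 d.
  have [F [h1 h2]] := cd'; exists F; split=> // x xF; rewrite /c2.
  by case: asboolP => // Wx; rewrite h2 // dd'.
(* [edges] lists each edge in one orientation only, so [B] is closed under reversal; with the factor
   in [cut_le4] this gives four times its size. *)
pose B2 := B ++ [seq (p.2, p.1) | p <- B].
have sB2 : size B2 = (size B).*2 by rewrite size_cat size_map addnn.
apply: eventually_mono (sm _ c2d) => n hn.
have : cut n c + cut n d <= cut n d' + cut n c2 + (size B2).*2; last first.
  by rewrite sB2; lia.
apply: cut_le4 => x y axy.
have hout z : ~ W z -> c z = d' z by move=> nW; apply: findiff_out cd' _ => -[].
have hin z : W z -> c z <> d z -> fin z.
  by move=> Wz cz; apply: contrapT => nf; apply: cz; rewrite -dd' //; apply: findiff_out cd' _ => -[].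
have key z w : adj z w -> W z -> ~ W w -> (z, w) \notin B ->
    (c z != d' w) + (d z != d w) <= (d z != d' w) + (c z != d w).
  move=> azw Wz nW nB; case: (boolP (c z == d z)) => [/eqP->|/eqP cz]; first by rewrite addnC.
  case: (boolP (d w == d' w)) => [/eqP<-|/eqP dw]; first by rewrite addnC.
  have dzw : d z = d w.
    by apply: contrapT => dzw; move/negP: nB; apply; apply: hB => //; apply: hin.
  by move: cz dw; rewrite dzw; case: (c z) (d w) (d' w) => [] [] [].
have sw z w : ((z, w) \in B2) = ((z, w) \in B) || ((w, z) \in B).
  rewrite mem_cat; congr (_ || _); apply/mapP/idP => [[[a b] /= ab [-> ->]]//|h].
  by exists (w, z).
have l2 (a b e f g : bool) : (a + b <= e + f + (g).*2) \/ ~~ g.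
  by case: g a b e f => [] [] [] [] []; auto.
case: (l2 (c x != c y) (d x != d y) (d' x != d' y) (c2 x != c2 y) ((x, y) \in B2)) => // nB.
rewrite (negbTE nB) addn0; move: nB; rewrite sw => /norP[nB1 nB2]; rewrite /c2.
case: asboolP => Wx; case: asboolP => Wy.
- by rewrite !dd' // addnC.
- by rewrite (hout y) // (dd' x) //; apply: key.
- rewrite (hout x) // (dd' y) // eq_sym [d x == _]eq_sym [d' x == _]eq_sym [d x == _]eq_sym.
  by apply: key => //; apply: adj_sym.
- by rewrite !hout // addnC.
Qed.

Lemma strong_max_transfer W d d' :
  strong_max W d -> (forall x, W x -> d' x = d x) ->
  (forall x y, W x -> fin x -> ~ W y -> adj x y -> d y = d' y) ->
  strong_max W d'.
Proof.
move=> sm dd' h c cd'.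
have hB x y : W x -> fin x -> ~ W y -> adj x y -> d y <> d' y -> d x <> d y ->
  (x, y) \in [::] by move=> Wx fx nW axy; rewrite (h x y).
by have := strong_max_perturb sm dd' hB cd'; apply: eventually_mono => n; rewrite addn0.
Qed.

(** Only the finitely many edges at [F] can change, which bounds the gain over [c]. *)
Lemma strong_max_list F c : (forall x, x \in F -> fin x) ->
  exists2 d, findiff (fun x => x \in F) d c & strong_max (fun x => x \in F) d.
Proof.
move=> fF; pose B0 := [seq (x, y) | x <- F, y <- nbrs x].
pose B := B0 ++ [seq (p.2, p.1) | p <- B0].
apply: (@strong_max_repair _ _ (size B).*2) => d dc.
apply: eventually_all => n.
rewrite -(leq_add2r (cut n c)) addnAC; apply: cut_le4 => x y axy.
have B0P z w : z \in F -> adj z w -> (z, w) \in B0.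
  by move=> zF azw; apply/allpairsPdep; exists z, w; split=> //; apply: nbrsP; auto.
case: (boolP ((x, y) \in B)) => hB; first by case: (_ != _) (_ != _) => [] [].
have xF : x \notin F.
  by apply: contra hB => xF; rewrite mem_cat B0P.
have yF : y \notin F.
  apply: contra hB => yF; rewrite mem_cat; apply/orP; right; apply/mapP.
  by exists (y, x) => //; apply: B0P => //; apply: adj_sym.
have dE z : z \notin F -> d z = c z.
  by move=> zF; apply: findiff_out dc _ => -[zF' _]; rewrite zF' in zF.
by rewrite !dE ?addn0.
Qed.


(** * Good vertex sets *)

Definition opposite c Y x y := [/\ adj x y, Y y & c y <> c x].

(* Opposite neighbours are counted in [Y] only: when blocks are coloured one
   after the other, the vertices outside [Y] have no final colour yet. *)
Definition good W := forall b Y, (forall x, W x -> Y x) ->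
  (forall x, W x -> ~ fin x -> infinite (fun y => adj x y /\ Y y)) ->
  exists c, [/\ forall x, ~ W x -> c x = b x, strong_max W c &
    forall x, W x -> ~ fin x -> infinite (opposite c Y x)].

Lemma good_ext W W' : (forall x, W x <-> W' x) -> good W -> good W'.
Proof. by move=> /predeqP ->. Qed.

Definition hgood W := forall W', (forall x, W' x -> W x) -> good W'.

Lemma hgood_sub W W' : (forall x, W' x -> W x) -> hgood W -> hgood W'.
Proof. by move=> s h U hU; apply: h => x /hU /s. Qed.

Lemma opposite_findiff W c d Y x : findiff W c d -> ~ fin x ->
  infinite (opposite c Y x) -> infinite (opposite d Y x).
Proof.
move=> cd nf; have [F [hF1 hF2]] := cd.
move=> ic; apply: (infinite_sub (s := F) ic) => y [axy Yy cy].
case: (boolP (y \in F)) => [yF|/hF2 cdy]; [by right | left; split=> //].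
by rewrite -cdy -(findiff_out cd) // => -[].
Qed.

(* If [s] has only finitely many opposite neighbours, flipping it cuts its
   edges to almost all of its neighbours, and by [strong_max_perturb] finitely
   many further flips of finite-degree vertices restore strong maximality. *)
Lemma good_add_infinite W (s : V) : good W -> ~ fin s ->
  good (fun x => W x \/ x = s).
Proof.
move=> gW ns; case: (pselect (W s)) => [Ws|nWs].
  by apply: good_ext gW => x; split=> [|[|->]]; auto.
move=> b Y WY hY.
have [c [c1 c2 c3]] := gW b Y (fun x Wx => WY x (or_introl Wx)) (fun x Wx => hY x (or_introl Wx)).
(* A finite recolouring never touches [s], whose degree is infinite. *)
have smS d : strong_max W d -> strong_max (fun x => W x \/ x = s) d.
  move=> sm e ed; apply: sm; apply: findiff_sub ed => x [|->] //.
case: (pselect (infinite (opposite c Y s))) => [hs|/infinitePn[l hl]].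
  exists c; split; [by move=> x /not_orP[/c1] | exact: smS |].
  by move=> x [|->] //; apply: c3.
pose d x := if x == s then ~~ c x else c x.
have dE x : x <> s -> d x = c x by rewrite /d => /eqP /negbTE ->.
have ds : d s = ~~ c s by rewrite /d eqxx.
pose B := [seq (x, s) | x <- l].
have [|e ed se] := @strong_max_repair W d (size B).*2.*2.
  apply: (strong_max_perturb c2).
    by move=> x Wx; apply: dE => xs; apply: nWs; rewrite -xs.
  move=> x y Wx fx nWy axy dy cxy.
  have ys : y = s by apply: contrapT => /dE yE; rewrite yE in dy.
  subst y; apply/mapP; exists x => //; apply: hl; split=> //; first exact: adj_sym.
  by apply: WY; left.
have eE x : ~ fin x -> e x = d x by move=> nf; apply: findiff_out ed _ => -[].
exists e; split; last move=> x [Wx|->] nf.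
- move=> x /not_orP[nW xs]; rewrite (findiff_out ed) ?dE ?c1 //.
  by move=> [].
- exact: smS.
- apply: (opposite_findiff (findiff_sym ed) nf).
  apply: (infinite_sub (s := [:: s]) (c3 x Wx nf)) => y [axy Yy cy].
  case: (pselect (y = s)) => [->|ys]; first by right; rewrite inE.
  by left; split=> //; rewrite !dE // => xs; apply: nWs; rewrite -xs.
- apply: (opposite_findiff (findiff_sym ed) ns).
  apply: (infinite_sub (s := s :: l) (hY s (or_intror erefl) ns)) => y [asy Yy].
  case: (boolP (y \in s :: l)) => [yl|]; first by right.
  rewrite inE => /norP[/eqP ys yl]; left; split=> //; rewrite dE // ds => cy.
  by move/negP: yl; apply; apply: hl; split=> //; rewrite cy; case: (c s).
Qed.

Lemma good_add_infinite_seq W F : good W -> (forall x, x \in F -> ~ fin x) ->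
  good (fun x => W x \/ x \in F).
Proof.
move=> gW; elim: F => [|s F IH] nF; first by apply: good_ext gW => x; split=> [|[]]; auto.
have nF' x : x \in F -> ~ fin x by move=> xF; apply: nF; rewrite inE xF orbT.
apply: good_ext (good_add_infinite (IH nF') (nF s (mem_head _ _))) => x.
rewrite inE; split=> [[[|->]|->]|[|/orP[/eqP|]]]; rewrite ?eqxx ?orbT; auto.
Qed.

(** Compactness: colours are fixed vertex by vertex in the order of codes, keeping agreement with
    infinitely many of the [d n]. *)
Lemma cluster_point (d : nat -> V -> bool) : exists c, forall (s : seq V) N,
  exists2 n, N <= n & {in s, d n =1 c}.
Proof.
pose upd (g : V -> bool) i t (x : V) := if pickle x == i then t else g x.
pose inv i (g : V -> bool) := forall N, exists2 n, N <= n &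
  forall x, pickle x < i -> d n x = g x.
have step i g : inv i g -> exists t, inv i.+1 (upd g i t).
  move=> ig; apply: contrapT => h.
  have h1 t : exists N, forall n, N <= n -> exists2 x, pickle x <= i & d n x <> upd g i t x.
    apply: contrapT => h1; apply: h; exists t => N; apply: contrapT => h2; apply: h1.
    exists N => n Nn; apply: contrapT => h3; apply: h2; exists n => // x xi.
    by apply: contrapT => h4; apply: h3; exists x.
  have [[N1 hN1] [N2 hN2]] := (h1 true, h1 false).
  have [n] := ig (maxn N1 N2); rewrite geq_max => /andP[/hN1[x xi hx] /hN2[y yi hy]] hn.
  have E (z : V) : pickle z <= i -> forall t, d n z <> upd g i t z -> pickle z = i /\ d n z <> t.
    move=> zi t; rewrite /upd; case: eqP => // /eqP zi'; rewrite hn // ltn_neqAle zi' //.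
  have [xE dx] := E _ xi _ hx; have [yE dy] := E _ yi _ hy.
  have xy : x = y by apply: (pcan_inj (@pickleK V)); rewrite xE yE.
  by subst y; move: dx dy; case: (d n x).
have /choice[T hT] (ig : nat * (V -> bool)) :
    exists t, inv ig.1 ig.2 -> inv ig.1.+1 (upd ig.2 ig.1 t).
  by case: (pselect (inv ig.1 ig.2)) => [/step[t ht]|ni]; [exists t | exists true].
pose g := fix g i := if i is j.+1 then upd (g j) j (T (j, g j)) else xpredT.
have gI i : inv i (g i) by elim: i => [N|i IH]; [exists N | apply: (hT (i, g i))].
have gE (x : V) i : pickle x < i -> g i x = g (pickle x).+1 x.
  elim: i => // i IH; rewrite ltnS leq_eqVlt => /orP[/eqP->//|xi].
  by rewrite -IH //= /upd; case: eqP xi => // ->; rewrite ltnn.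
exists (fun x => g (pickle x).+1 x) => s N.
have [M hM] := verts_sub s; have [n Nn hn] := gI M N.
exists n => // x /(hM M (leqnn _)); rewrite mem_verts => xM.
by rewrite hn // gE.
Qed.

(** Every vertex of [W] gets infinitely many turns; at each it takes a neighbour in [W] not yet
    fixed and gives it the opposite colour. *)
Lemma alternate_coloring W :
  (forall x, W x -> infinite (fun y => adj x y /\ W y)) ->
  exists c, forall x, W x -> infinite (opposite c W x).
Proof.
move=> iW.
have /choice[nx nxP] (xs : V * seq V) :
    exists y, W xs.1 -> [/\ adj xs.1 y, W y & y \notin xs.2].
  case: (pselect (W xs.1)) => [/iW/(_ xs.2)[y [? ?] ?]|?]; first by exists y.
  by exists xs.1.
(* The exponent of 2 takes every value infinitely often, for instance at [2 ^ p * 3 ^ M]. *)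
pose w n : option V := pickle_inv (logn 2 n).
have wP (x : V) M : exists2 n, M <= n & w n = Some x.
  exists (2 ^ pickle x * 3 ^ M).
    rewrite -[M in M <= _]mul1n leq_mul ?expn_gt0 //; exact/ltnW/ltn_expl.
  by rewrite /w lognM ?expn_gt0 // !lognX /= muln1 muln0 addn0 pickleK_inv.
(* The second component lists the vertices whose colour is final. *)
pose step n (fu : (V -> bool) * seq V) :=
  if w n is Some x then
    if `[< W x >] then
      let y := nx (x, x :: fu.2) in
      (fun z => if z == y then ~~ fu.1 x else fu.1 z, [:: y, x & fu.2])
    else fu
  else fu.
pose st := fix st n := if n is m.+1 then step m (st m) else (xpredT, [::]).
have subS n : {subset (st n).2 <= (st n.+1).2}.
  move=> z; rewrite /= /step; case: (w n) => [x|] //; case: ifP => // _.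
  by rewrite !inE => ->; rewrite !orbT.
have eqS n z : z \in (st n).2 -> (st n.+1).1 z = (st n).1 z.
  rewrite /= /step; case: (w n) => [x|] //; case: asboolP => //= Wx zs.
  have [_ _] := nxP (x, x :: (st n).2) Wx; rewrite inE => /norP[_].
  by case: eqP => // <-; rewrite zs.
have subm n m : n <= m -> {subset (st n).2 <= (st m).2}.
  move=> /subnK <-; elim: (m - n) => // k IH z /IH; exact: subS.
have eqm n m z : n <= m -> z \in (st n).2 -> (st m).1 z = (st n).1 z.
  move=> /subnK <- zs; elim: (m - n) => // k IH; rewrite -IH; apply: eqS.
  by apply: subm zs; apply: leq_addl.
have stW n x : w n = Some x -> W x -> exists y,
    [/\ adj x y, W y, y \notin (st n).2, y \in (st n.+1).2 &
        x \in (st n.+1).2 /\ (st n.+1).1 y <> (st n.+1).1 x].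
  move=> wn Wx; have [] := nxP (x, x :: (st n).2) Wx.
  set y := nx _ => axy Wy; rewrite inE => /norP[yx yn]; exists y.
  rewrite /= /step wn asboolT //= -/y; split=> //; rewrite ?inE ?eqxx ?orbT //.
  split=> //; rewrite [x == y]eq_sym (negbTE yx); by case: ((st n).1 x).
(* [N x] is a stage at which [x] is already final if it ever becomes so; its colour is read off
   there. *)
have /choice[N hN] (x : V) : exists n, forall m, x \in (st m).2 -> x \in (st n).2.
  case: (pselect (exists m, x \in (st m).2)) => [[m hm]|h]; first by exists m.
  by exists 0 => m hm; case: h; exists m.
exists (fun x => (st (N x)).1 x) => x Wx s.
have cE z n : z \in (st n).2 -> (st (N z)).1 z = (st n).1 z.
  move=> zn; case: (leqP n (N z)) => nN; first exact: eqm.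
  by rewrite (eqm (N z) n) // ?(ltnW nN) //; apply: hN zn.
have [n nM wn] := wP x (\max_(z <- s) N z).
have [y [axy Wy yn yS [xS yx]]] := stW _ _ wn Wx.
exists y; first by split=> //; rewrite (cE y n.+1) // (cE x n.+1).
apply: contra yn => ys; apply: (subm (N y)); last exact: hN yS.
by apply: leq_trans nM; rewrite (big_rem y) //= leq_maxl.
Qed.

(* A Zorn-maximal partial colouring in which every coloured vertex already has
   infinitely many opposite neighbours leaves uncoloured only vertices with
   infinitely many uncoloured neighbours. *)
Lemma good_infinite W : (forall x, W x -> ~ fin x) -> good W.
Proof.
move=> nW b Y WY hY.
pose col (D : V -> Prop) y := Y y /\ (~ W y \/ D y).
pose adm (p : (V -> Prop) * (V -> bool)) :=
  [/\ forall x, p.1 x -> W x, forall x, ~ W x -> p.2 x = b x &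
      forall x, p.1 x -> infinite (opposite p.2 (col p.1) x)].
pose T := {p | adm p}.
pose le (p q : (V -> Prop) * (V -> bool)) :=
  (forall x, p.1 x -> q.1 x) /\ (forall x, p.1 x -> q.2 x = p.2 x).
have adm0 : adm (fun=> False, b) by [].
pose t0 : T := exist _ _ adm0.
have [|||[[D f] [/= DW fb Dopp]] tmax] := @classical_sets.ZL_preorder T t0 (fun p q => `[< le (sval p) (sval q) >]).
{ by move=> p; apply/asboolP. }
{ move=> q p r /asboolP[h1 h2] /asboolP[h3 h4]; apply/asboolP; split=> x px; auto.
  by rewrite h4 ?h2 //; auto. }
{ move=> A totA.
  pose D x := exists2 p : T, A p & (sval p).1 x.
  have /choice[f hf] (x : V) : exists t, (~ D x -> t = b x) /\
      forall p : T, A p -> (sval p).1 x -> t = (sval p).2 x.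
    case: (pselect (D x)) => [[p Ap px]|nD].
      exists ((sval p).2 x); split=> [[]|q Aq qx]; first by exists p.
      by case: (totA _ _ Ap Aq) => /asboolP[_ h]; [apply/esym/h | apply/h].
    by exists (b x); split=> // p Ap px; case: nD; exists p.
  have admD : adm (D, f).
  { split=> /= [x [p Ap px]|x nWx|x [p Ap px]].
    + by have [h _ _] := svalP p; apply: h.
    + by have [-> //] := hf x; move=> [p Ap px]; have [h _ _] := svalP p; apply/nWx/h.
    + have [h1 h2 h3] := svalP p.
      apply: (infinite_sub (s := [::]) (h3 _ px)) => y [axy [Yy hy] cy]; left.
      split=> //; first by split=> //; case: hy => hy; [left | right; exists p].
      rewrite (proj2 (hf x) p Ap px).
      case: hy => hy; last by rewrite (proj2 (hf y) p Ap hy).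
      rewrite (proj1 (hf y)) -?h2 //.
      by move=> [q Aq qy]; have [h _ _] := svalP q; apply/hy/h. }
  exists (exist _ _ admD) => p Ap; apply/asboolP; split=> /= x px; first by exists p.
  exact: (proj2 (hf x)). }
have finD x : W x -> ~ D x -> exists s : seq V, forall y, adj x y /\ col D y -> y \in s.
  move=> Wx nDx; apply/infinitePn => inf.
  (* One colour occurs infinitely often among the settled neighbours, so giving [x] the other colour
     [t] would enlarge [D]. *)
  have [t ht] : exists t, infinite (fun y => [/\ adj x y, col D y & f y <> t]).
    apply: contrapT => h.
    have [s1 h1] : exists s : seq V, forall y, [/\ adj x y, col D y & f y <> true] -> y \in s.
      by apply/infinitePn => h2; apply: h; exists true.
    have [s2 h2] : exists s : seq V, forall y, [/\ adj x y, col D y & f y <> false] -> y \in s.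
      by apply/infinitePn => h2; apply: h; exists false.
    have [y [axy cy]] := inf (s1 ++ s2); rewrite mem_cat => /norP[/negP y1 /negP y2].
    case fy: (f y); [apply: y2; apply: h2 | apply: y1; apply: h1]; by rewrite fy.
  pose g y := if y == x then t else f y.
  have gx : g x = t by rewrite /g eqxx.
  have gE y : y <> x -> g y = f y by rewrite /g => /eqP/negbTE->.
  have gD y : ~ W y \/ D y -> g y = f y.
    by move=> hy; apply: gE => yx; subst y; case: hy.
  have admq : adm (fun y => D y \/ y = x, g).
    split=> /= [y [|->]|y nWy|z hz]; auto; first by rewrite gD ?fb //; left.
    case: (pselect (D z)) => [Dz|nDz].
      apply: (infinite_sub (s := [::]) (Dopp _ Dz)) => y [azy [Yy hy] cy]; left.
      split=> //; first by split=> //; case: hy; auto.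
      by rewrite !gD //; right.
    have zx : z = x by case: hz.
    subst z; apply: (infinite_sub (s := [::]) ht) => y [axy [Yy hy] cy]; left.
    split=> //; first by split=> //; case: hy; auto.
    by rewrite gx gD.
  have /asboolP[/= hq _] : `[< le (sval (exist _ _ admq : T)) (D, f) >].
    apply: (tmax (exist _ _ admq)); apply/asboolP; split=> /= y Dy; first by left.
    by rewrite gD //; right.
  by apply/nDx/hq; right.
(* By [finD] all but finitely many neighbours in [Y] of an uncoloured vertex are uncoloured
   themselves. *)
have [g hg] : exists g, forall x, W x /\ ~ D x -> infinite (opposite g (fun x => W x /\ ~ D x) x).
  apply: alternate_coloring => x [Wx nDx].
  have [s hs] := finD x Wx nDx.
  apply: (infinite_sub (s := s) (hY x Wx (nW x Wx))) => y [axy Yy].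
  case: (pselect (W y /\ ~ D y)) => hy; first by left.
  right; apply: hs; split=> //; split=> //.
  by case/not_andP: hy => [|/contrapT]; auto.
pose c x := if `[< W x /\ ~ D x >] then g x else f x.
have cg x : W x /\ ~ D x -> c x = g x by rewrite /c => h; rewrite asboolT.
have cf x : ~ (W x /\ ~ D x) -> c x = f x by rewrite /c => h; rewrite asboolF.
exists c; split.
- by move=> x nWx; rewrite cf ?fb // => -[].
- move=> d dc; have -> : d = c by apply/funext => x; apply: findiff_out dc _ => -[/nW].
  exact: eventually_all.
- move=> x Wx nf; case: (pselect (D x)) => [Dx|nDx].
    apply: (infinite_sub (s := [::]) (Dopp _ Dx)) => y [axy [Yy hy] cy]; left.
    have cfy : c y = f y by apply: cf => -[]; case: hy.
    have cfx : c x = f x by apply: cf => -[].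
    by split=> //; rewrite cfx cfy.
  apply: (infinite_sub (s := [::]) (hg x (conj Wx nDx))) => y [axy hy cy]; left.
  by split=> //; [case: hy => /WY | rewrite !cg].
Qed.

(** * Blocks with boundary of finite degree *)

(* The finitely many colour patterns on the far side of [B] are the only
   information about the outside that matters to [E], so the repaired
   colourings differ from [c0] on a common finite set. *)
Lemma finite_recoloring (C E : V -> Prop) (B : seq (V * V)) c0 cE :
  (forall x y, adj x y -> E x -> C y -> ~ E y -> (x, y) \in B) ->
  strong_max E cE -> (forall x, E x -> c0 x = cE x) ->
  (forall x, ~ C x -> c0 x = cE x) ->
  exists M : seq V, (forall x, x \in M -> E x /\ fin x) /\
    forall a, findiff C a c0 -> exists a', [/\ findiff E a' a,
      forall x, E x -> x \notin M -> a' x = c0 x &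
      eventually (fun n => cut n a <= cut n a')].
Proof.
move=> hB sE c0E c0C.
pose N := [seq p.2 | p <- B].
(* The mask [m] selects the far ends of [B] on which the outside colouring departs from [c0]. *)
pose am m x := c0 x (+) ((x \in mask m N) && `[< C x /\ ~ E x >]).
have amE m x : ~ (C x /\ ~ E x) -> am m x = c0 x.
  by move=> h; rewrite /am (asboolF h) andbF addbF.
have /choice[g hg] m : exists g, findiff E g (am m) /\ strong_max E g.
  have [|g g1 g2] := @strong_max_repair E (am m) (size B).*2.*2; last by exists g.
  apply: (strong_max_perturb sE) => [x Ex|x y Ex fx nEy axy dy _].
    by rewrite amE ?c0E // => -[].
  apply: hB => //; apply: contrapT => nCy; apply: dy.
  by rewrite amE ?c0C // => -[].
have /choice[F hF] m : exists F : seq V, (forall x, x \in F -> E x /\ fin x) /\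
    forall x, x \notin F -> g m x = am m x by have [] := hg m.
pose M := flatten [seq F (val t) | t : (size N).-tuple bool].
exists M; split=> [x /flatten_mapP[t _]|a ac].
  by have [h _] := hF (val t); apply: h.
pose m := [seq a y != c0 y | y <- N].
have mM : {subset F m <= M}.
  have sm : size m == size N by rewrite size_map.
  by move=> x xF; apply/flatten_mapP; exists (Tuple sm); rewrite ?mem_enum.
have amN y : C y -> ~ E y -> y \in N -> am m y = a y.
  move=> Cy nEy yN; rewrite /am asboolT // andbT -filter_mask mem_filter yN andbT.
  by case: (a y) (c0 y) => [] [].
pose a' x := if `[< E x >] then g m x else a x.
have a'E x : E x -> a' x = g m x by move=> h; rewrite /a' asboolT.
have a'N x : ~ E x -> a' x = a x by move=> h; rewrite /a' asboolF.
have a'a : findiff E a' a.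
  have [Fa [h1 h2]] := ac; have [h3 h4] := hF m.
  exists [seq x <- F m ++ Fa | `[< E x >]]; split=> x; rewrite mem_filter mem_cat.
    by move=> /andP[/asboolP Ex /orP[/h3|/h1[_]]].
  case: asboolP => /= [Ex /norP[/h4 e1 /h2 e2]|/a'N //].
  by rewrite a'E // e1 e2 amE // => -[].
exists a'; split=> // [x Ex xM|].
  have [_ h4] := hF m; rewrite a'E // h4 ?amE // => [[]//|].
  by apply: contra xM => /mM.
have [g1 g2] := hg m.
apply: (strong_max_transfer g2); last exact: findiff_sym.
  by move=> x Ex; rewrite a'E.
move=> x y Ex fx nEy axy; rewrite a'N // (findiff_out g1); last by case.
case: (pselect (C y)) => [Cy|nCy].
  by apply: amN => //; apply/mapP; exists (x, y) => //; apply: hB.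
by rewrite amE ?(findiff_out ac) // => -[].
Qed.

(** Each block is coloured on its own. By [finite_recoloring] only a finite part [M k] of it ever
    needs other colours, so optimal colourings of the growing finite sets [Free n] have a cluster
    point that is strongly maximal in [C]. Vertices of infinite degree lie in blocks and lose only
    finitely many opposite neighbours. *)
Lemma good_disjoint_blocks (C : V -> Prop) (E : nat -> V -> Prop)
    (B : nat -> seq (V * V)) :
  (forall k x, E k x -> C x) ->
  (forall j k x, E j x -> E k x -> j = k) ->
  (forall k, good (E k)) ->
  (forall k x y, adj x y -> E k x -> C y -> ~ E k y -> (x, y) \in B k) ->
  (forall x, C x -> (forall k, ~ E k x) -> fin x) ->
  good C.
Proof.
move=> EC Edis gE hB Cfin b Y CY hY.
have /choice[ck hck] k : exists c, [/\ forall x, ~ E k x -> c x = b x, strong_max (E k) c &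
    forall x, E k x -> ~ fin x -> infinite (opposite c Y x)].
  by apply: gE => x /EC; [apply: CY | apply: hY].
have /choice[c0 hc0] (x : V) : exists t, (forall k, E k x -> t = ck k x) /\
    ((forall k, ~ E k x) -> t = b x).
  case: (pselect (exists k, E k x)) => [[k Ek]|h].
    by exists (ck k x); split=> [j Ej|/(_ k)//]; rewrite (Edis _ _ _ Ej Ek).
  by exists (b x); split=> // k Ek; case: h; exists k.
have c0E k x : E k x -> c0 x = ck k x by have [h _] := hc0 x; apply: h.
have c0b x : (forall k, ~ E k x) -> c0 x = b x by have [_ h] := hc0 x; apply: h.
have c0C x : ~ C x -> c0 x = b x by move=> nC; apply: c0b => k /EC.
have /choice[M hM] k : exists M : seq V, (forall x, x \in M -> E k x /\ fin x) /\
    forall a, findiff C a c0 -> exists a', [/\ findiff (E k) a' a,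
      forall x, E k x -> x \notin M -> a' x = c0 x &
      eventually (fun n => cut n a <= cut n a')].
  have [h1 h2 h3] := hck k; apply: (finite_recoloring (hB k) h2) => [x /c0E //|x nCx].
  by rewrite c0C // h1 // => /EC.
have ME k x : x \in M k -> E k x /\ fin x by have [h _] := hM k; apply: h.
pose Free n := [seq x <- verts n | `[< C x /\ forall k, ~ E k x >]] ++
  flatten [seq M k | k <- iota 0 n].
have FreeP n x : x \in Free n -> (C x /\ forall k, ~ E k x) \/ exists k, x \in M k.
  rewrite mem_cat mem_filter => /orP[/andP[/asboolP]|/flatten_mapP[k _ ?]]; first by left.
  by right; exists k.
have FreeC n x : x \in Free n -> C x by case/FreeP => [[]|[k /ME[/EC]]].
have FreeF n x : x \in Free n -> fin x by case/FreeP => [[? ?]|[k /ME[]]] //; apply: Cfin.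
have /choice[d hd] n : exists d, findiff (fun x => x \in Free n) d c0 /\
    strong_max (fun x => x \in Free n) d.
  by have [d d1 d2] := strong_max_list c0 (@FreeF n); exists d.
pose Z n x := C x /\ ((forall k, ~ E k x) /\ x \in verts n \/ exists2 k, k < n & E k x).
have smZ n : strong_max (Z n) (d n).
{ move=> c cd; have [d1 d2] := hd n.
  have dc0 : findiff C (d n) c0 by apply: findiff_sub d1 => x /FreeC.
  (* Restoring [c0] off [M k] in one block after another never lowers the cut, and turns a
     recolouring of [Z n] into one of [Free n]. *)
  have norm j : j <= n -> exists a, [/\ findiff (Z n) a (d n),
      forall k x, k < j -> E k x -> x \notin M k -> a x = c0 x &
      eventually (fun i => cut i c <= cut i a)].
  { elim: j => [_|j IH jn]; first by exists c; split=> //; apply: eventually_all.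
    have [a [a1 a2 a3]] := IH (ltnW jn).
    have [_ /(_ a)[]] := hM j.
      by apply: findiff_trans dc0; apply: findiff_sub a1 => x [].
    move=> a' [h1 h2 h3]; exists a'; split.
    - apply: findiff_trans a1; apply: findiff_sub h1 => x Ex _; split; first exact: EC Ex.
      by right; exists j.
    - move=> k x; rewrite ltnS leq_eqVlt => /orP[/eqP->|kj] Ek xM; first exact: h2.
      rewrite (findiff_out h1); first exact: a2 Ek xM.
      by move=> [/Edis/(_ Ek) jk]; rewrite jk ltnn in kj.
    - by apply: eventually_mono (eventually_and a3 h3) => i []; apply: leq_trans. }
  have [a [a1 a2 a3]] := norm n (leqnn _).
  apply: eventually_mono (eventually_and a3 (d2 a _)) => [i []|]; first exact: leq_trans.
  exists (Free n); split=> x xF; first by split=> //; apply: FreeF xF.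
  case: (pselect (Z n x)) => [[Cx [[nE xn]|[k kn Ek]]]|nZ].
  - by move: xF; rewrite mem_cat mem_filter asboolT // xn.
  - rewrite (a2 k) //; last first.
      apply: contra xF => xM; rewrite mem_cat; apply/orP; right.
      by apply/flatten_mapP; exists k; rewrite ?mem_iota.
    by apply/esym; apply: findiff_out d1 _ => -[xF' _]; rewrite xF' in xF.
  - by apply: findiff_out a1 _ => -[]. }
have [c hc] := cluster_point d.
have cE x : (forall n, x \notin Free n) -> c x = c0 x.
  move=> nF; have [n _ h] := hc [:: x] 0; rewrite -h ?mem_head //.
  by have [d1 _] := hd n; apply: findiff_out d1 _ => -[xF _]; have := nF n; rewrite xF.
have cb x : ~ C x -> c x = b x.
  by move=> nC; rewrite cE ?c0C // => n; apply/negP => /FreeC.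
exists c; split=> // [e ec|x Cx nf].
{ have [F [F1 F2]] := ec.
  have [N hN] : exists N, forall n x, N <= n -> x \in F -> Z n x.
    have : forall x, x \in F -> C x by move=> x /F1[].
    elim: (F) => [|x s IH] sC; first by exists 0.
    have [N hN] := IH (fun y ys => sC y (mem_behead (s := x :: s) ys)).
    have Cx : C x by apply: sC; apply: mem_head.
    have [K hK] : exists K, forall n, K <= n -> Z n x.
      case: (pselect (exists k, E k x)) => [[k Ek]|h].
        by exists k.+1 => n kn; split=> //; right; exists k.
      exists (pickle x).+1 => n xn; split=> //; left; rewrite mem_verts; split=> // k Ek.
      by apply: h; exists k.
    exists (maxn N K) => n y; rewrite geq_max => /andP[Nn Kn].
    by rewrite inE => /orP[/eqP->|ys]; [apply: hK | apply: hN].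
  (* Here [d n] agrees with [c] on [F] and its neighbours, so recolouring [F] gains the same from
     [c] as from [d n]. *)
  have [n Nn hn] := hc (F ++ flatten [seq nbrs x | x <- F]) N.
  pose e' x := if x \in F then e x else d n x.
  have e'd : findiff (Z n) e' (d n).
    exists F; split=> x xF; last by rewrite /e' (negbTE xF).
    by split; [apply: hN | have [] := F1 x xF].
  apply: eventually_mono (smZ n _ e'd) => i hi.
  suff : cut i e + cut i (d n) <= cut i c + cut i e' + (size ([::] : seq (V * V))).*2 by rewrite addn0; lia.
  apply: cut_le4 => x y axy; rewrite in_nil addn0.
  have dn z w : z \in F -> adj z w -> d n w = c w.
    move=> zF azw; apply: hn; rewrite mem_cat; apply/orP; right.
    by apply/flatten_mapP; exists z => //; apply: nbrsP => //; have [] := F1 z zF.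
  have dF z : z \in F -> d n z = c z by move=> zF; apply: hn; rewrite mem_cat zF.
  rewrite /e'; case: (boolP (x \in F)) => xF; case: (boolP (y \in F)) => yF.
  - by rewrite !dF // addnC.
  - by rewrite (F2 y) // (dF x) // (dn x y) // addnC.
  - by rewrite (F2 x) // (dF y) // (dn y x (yF) (adj_sym axy)) addnC.
  - by rewrite !F2 // addnC. }
have [k Ek] : exists k, E k x.
  by apply: contrapT => h; apply: nf; apply: Cfin => // k Ek; apply: h; exists k.
have [h1 h2 h3] := hck k.
have cEk z : E k z -> z \notin M k -> c z = ck k z.
  move=> Ez zM; rewrite cE ?(c0E k) // => n; apply/negP => /FreeP[[_ /(_ k)]//|[j zMj]].
  have [/Edis/(_ Ez) jk _] := ME _ _ zMj.
  by rewrite -jk zMj in zM.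
have ckx : c x = ck k x by apply: cEk => //; apply/negP => /ME[_].
apply: (infinite_sub (s := M k ++ [seq p.2 | p <- B k]) (h3 x Ek nf)) => y [axy Yy cy].
case: (boolP (y \in M k)) => yM; first by right; rewrite mem_cat yM.
case: (pselect (E k y)) => [Ey|nEy]; first by left; split=> //; rewrite ckx cEk.
case: (pselect (C y)) => [Cy|nCy]; last by left; split=> //; rewrite ckx cb // -h1.
by right; rewrite mem_cat; apply/orP; right; apply/mapP; exists (x, y) => //; apply: hB Ek _ _.
Qed.

(** The blocks may overlap, so a vertex is assigned to the first block containing it. An edge
    leaving trimmed block [k] ends in [S k], or it enters an earlier block [j] and starts in [S j].
    These ends have finite degree, so there are finitely many such edges. *)
Lemma hgood_finite_boundary (C : V -> Prop) (E : nat -> V -> Prop) (S : nat -> seq V) :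
  (forall k, hgood (E k)) ->
  (forall k x, x \in S k -> C x -> fin x) ->
  (forall k x y, C y -> adj x y -> E k x -> E k y \/ y \in S k) ->
  (forall x, C x -> (exists k, E k x) \/ fin x) ->
  hgood C.
Proof.
move=> hE hS hN hC W WC.
pose E' k x := [/\ W x, E k x & forall j, j < k -> ~ E j x].
have minE k x : W x -> E k x -> exists2 j, j <= k & E' j x.
  move=> Wx; elim/ltn_ind: k => k IH Ek.
  case: (pselect (exists2 j, j < k & E j x)) => [[j jk /(IH _ jk)[i ij]]|h].
    by exists i => //; apply: leq_trans ij (ltnW jk).
  by exists k => //; split=> // j jk Ej; apply: h; exists j.
pose out (S : seq V) := flatten [seq [seq (x, y) | y <- nbrs x] | x <- S & `[< fin x >]].
have outP (s : seq V) x y : x \in s -> fin x -> adj x y -> (x, y) \in out s.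
  move=> xs fx axy; apply/flatten_mapP; exists x; first by rewrite mem_filter asboolT.
  by apply: map_f; apply: nbrsP.
pose B k := [seq (p.2, p.1) | p <- out (S k)] ++ flatten [seq out (S j) | j <- iota 0 k].
apply: (@good_disjoint_blocks W E' B).
- by move=> k x [].
- move=> j k x [Wx Ej hj] [_ Ek hk]; case: (ltngtP j k) => // [/hk|/hj] //.
- by move=> k; apply: (hE k) => x [].
- move=> k x y axy [Wx Ek hk] Wy nE.
  case: (pselect (E k y)) => [Ey|nEy].
    have [j jk [_ Ej hj]] := minE _ _ Wy Ey.
    move: jk; rewrite leq_eqVlt => /orP[/eqP jk|jk]; first by subst j; case: nE.
    have [/(hk j jk)//|xS] := hN j y x (WC _ Wx) (adj_sym axy) Ej.
    rewrite mem_cat; apply/orP; right; apply/flatten_mapP; exists j; first by rewrite mem_iota.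
    by apply: outP => //; apply: hS xS (WC _ Wx).
  have [//|yS] := hN k x y (WC _ Wy) axy Ek.
  rewrite mem_cat; apply/orP; left; apply/mapP; exists (y, x) => //.
  by apply: outP (adj_sym axy) => //; apply: hS yS (WC _ Wy).
- move=> x Wx nE; have [[k Ek]|//] := hC x (WC _ Wx).
  by have [j _ /nE] := minE _ _ Wx Ek.
Qed.

(** * Blocks with boundary of infinite degree *)

(** There are three passes: the blocks are coloured in stages ([f]), then the vertices belonging to
    no stage, all of infinite degree ([g]), and finally strong maximality is repaired inside each
    stage ([c]). The repairs do not interfere, since finite-degree vertices of different stages are
    never adjacent. *)
Lemma good_infinite_boundary (C : V -> Prop) (E : nat -> V -> Prop) (S : nat -> seq V) :
  (forall k, hgood (E k)) ->
  (forall k x, E k x -> C x) ->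
  (forall k x, x \in S k -> C x -> ~ fin x) ->
  (forall k x y, C y -> adj x y -> E k x -> E k y \/ y \in S k) ->
  (forall x, C x -> (exists k, E k x) \/ ~ fin x) ->
  (forall x, C x -> (forall k, ~ E k x) ->
     exists m, forall y, C y -> adj x y -> ~ fin y \/ E m y) ->
  good C.
Proof.
move=> hE EC hS hN hC hT b Y CY hY.
(* [P k] is coloured before step [k]; a vertex of [S k] is coloured at step
   [k] exactly when it has infinitely many neighbours in the block coloured
   then, so the vertices of [S k] coloured later disturb the block along
   finitely many edges only. *)
pose X k (P : V -> Prop) x := [/\ C x, ~ P x &
  E k x \/ x \in S k /\ infinite (fun y => [/\ adj x y, E k y & ~ P y])].
pose P := fix P k := if k is j.+1 then fun x => P j x \/ X j (P j) x else fun=> False.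
pose XX k := X k (P k).
have PS k x : P k.+1 x <-> P k x \/ XX k x by [].
have Pm j k x : j <= k -> P j x -> P k x.
  by move=> /subnK <-; elim: (k - j) => // i IH /IH Px; left.
have PX k x : P k x -> exists2 j, j < k & XX j x.
  elim: k => // k IH /PS[/IH[j jk Xj]|Xk]; last by exists k.
  by exists j => //; apply: ltnW.
have XP j k x : j < k -> XX j x -> P k x by move=> jk Xj; apply: Pm jk _; right.
have PC k x : P k x -> C x by case/PX => j _ [].
have EP k x : E k x -> P k.+1 x.
  move=> Ek; case: (pselect (P k x)) => Pk; [by left | right; split; auto].
  exact: EC Ek.
have XE k x : XX k x -> fin x -> E k x /\ ~ P k x.
  by move=> [Cx nP [|[/hS/(_ Cx)]]].
have Xdis j k x : XX j x -> XX k x -> j = k.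
  move=> Xj Xk; case: (ltngtP j k) => // jk.
    by have [_ []] := Xk; apply: XP Xj.
  by have [_ []] := Xj; apply: XP Xk.
have gX k : good (XX k).
  pose s := [seq x <- S k | `[< [/\ C x, ~ P k x & infinite (fun y => [/\ adj x y, E k y & ~ P k y])] >]].
  have gE : good (fun x => E k x /\ ~ P k x) by apply: (hE k) => x [].
  have /(good_add_infinite_seq gE) : forall x, x \in s -> ~ fin x.
    by move=> x; rewrite mem_filter => /andP[/asboolP[Cx _ _]] /hS; apply.
  apply: good_ext => x; rewrite mem_filter; split.
    case=> [[Ek nP]|/andP[/asboolP[Cx nP ix] xS]]; split; auto; exact: EC Ek.
  by move=> [Cx nP [Ek|[xS ix]]]; [left | right; rewrite asboolT].
(* Only finitely many of these vertices will be recoloured by the repairs. *)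
pose Yk k y := (Y y /\ ~ C y) \/ P k.+1 y.
have hYk k x : XX k x -> ~ fin x -> infinite (fun y => adj x y /\ Yk k y).
  move=> [Cx nP hx] nf; case: (pselect (E k x)) => [Ek|nE].
    apply: (infinite_sub (s := S k) (hY x Cx nf)) => y [axy Yy].
    case: (pselect (C y)) => [Cy|nCy]; last by left; split=> //; left.
    by have [/EP Py|] := hN k x y Cy axy Ek; [left; split=> //; right | right].
  case: hx => // -[xS ix]; apply: (infinite_sub (s := [::]) ix) => y [axy Ey nPy].
  by left; split=> //; right; apply: EP.
have /choice[G hG] (kf : nat * (V -> bool)) : exists c,
    [/\ forall x, ~ XX kf.1 x -> c x = kf.2 x, strong_max (XX kf.1) c &
        forall x, XX kf.1 x -> ~ fin x -> infinite (opposite c (Yk kf.1) x)].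
  by apply: gX => [x Xx|x Xx]; [right; right | apply: hYk].
pose f := fix f k := if k is j.+1 then G (j, f j) else b.
have fS k x : ~ XX k x -> f k.+1 x = f k x by have [h _ _] := hG (k, f k); apply: h.
have fm k : strong_max (XX k) (f k.+1) by have [_ h _] := hG (k, f k).
have fo k x : XX k x -> ~ fin x -> infinite (opposite (f k.+1) (Yk k) x).
  by have [_ _ h] := hG (k, f k); apply: h.
have fP j k x : j <= k -> P j x -> f k x = f j x.
  move=> jk Px; rewrite -(subnK jk); elim: (k - j) => // i IH.
  by rewrite addSn fS // => -[_ nP _]; apply: nP; apply: Pm Px; apply: leq_addl.
have fb k x : ~ C x -> f k x = b x.
  by move=> nC; elim: k => // k IH; rewrite fS // => -[].
have /choice[fi hfi] (x : V) : exists t, (forall k, P k x -> t = f k x) /\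
    ((forall k, ~ P k x) -> t = b x).
  case: (pselect (exists k, P k x)) => [[k Pk]|h].
    exists (f k x); split=> [j Pj|/(_ k)//].
    by case: (leqP j k) => jk; [|apply/esym]; apply: fP => //; apply: ltnW.
  by exists (b x); split=> // k Pk; case: h; exists k.
pose R x := C x /\ forall k, ~ P k x.
have Rinf x : R x -> ~ fin x.
  by move=> [Cx nP]; have [[k /EP/nP]|] := hC x Cx.
(* A vertex of [S k] with infinitely many neighbours in the fresh part of block [k] would have been
   coloured by the end of step [k]. *)
have finN t k : R t -> exists s : seq V, forall y, adj t y -> P k y -> y \in s.
{ move=> [Ct nP]; elim: k => [|k [s hs]]; first by exists [::].
  have [s2 hs2] : exists s : seq V, forall y, [/\ adj t y, E k y & ~ P k y] -> y \in s.
    case: (pselect (t \in S k)) => tS.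
      apply/infinitePn => ix; apply: (nP k.+1); right; split=> //; by right.
    exists [::] => y [aty Ey _]; have [/EP/nP //|tS'] := hN k y t Ct (adj_sym aty) Ey.
    by case: tS.
  exists (s ++ s2 ++ S k) => y aty /PS[Py|[Cy nPy [Ey|[yS _]]]]; rewrite !mem_cat.
  - by rewrite hs.
  - by rewrite hs2 ?orbT.
  - by rewrite yS !orbT. }
(* Finite-degree vertices of [C] are left out because the repairs may still recolour them. *)
pose Y2 y := Y y /\ (~ C y \/ ~ fin y).
have [||g [g1 _ g3]] := @good_infinite R Rinf fi Y2.
{ by move=> x Rx; split; [case: Rx => /CY | right; apply: Rinf]. }
{ move=> t Rt nf; have [Ct nP] := Rt.
  have [m hm] := hT t Ct (fun k Ek => nP _ (EP _ _ Ek)).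
  have [s hs] := finN t m.+1 Rt.
  apply: (infinite_sub (s := s) (hY t Ct nf)) => y [aty Yy].
  case: (pselect (C y)) => [Cy|nCy]; last by left; split=> //; split=> //; left.
  by have [nfy|/EP Py] := hm y Cy aty; [left; split=> //; split=> //; right | right; apply: hs]. }
have gP k x : P k x -> g x = f k x.
  by move=> Px; rewrite g1; [have [h _] := hfi x; apply: h | case=> _ /(_ k)].
have gb x : ~ C x -> g x = b x.
  move=> nC; rewrite g1; last by case.
  by have [_ ->] := hfi x => // k /PC.
have /choice[h hh] k : exists h, findiff (XX k) h g /\ strong_max (XX k) h.
  have /choice[L hL] (y : V) : exists s : seq V,
      ~ infinite (fun x => [/\ adj y x, E k x & ~ P k x]) ->
      forall x, [/\ adj y x, E k x & ~ P k x] -> x \in s.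
    case: (pselect (infinite (fun x => [/\ adj y x, E k x & ~ P k x]))) => [?|]; first by exists [::].
    by move/infinitePn => [s hs]; exists s.
  pose B := flatten [seq [seq (x, y) | x <- L y] | y <- S k].
  have [|h h1 h2] := @strong_max_repair (XX k) g (size B).*2.*2; last by exists h.
  apply: (strong_max_perturb (fm k)) => [x Xx|x y Xx fx nXy axy fg _].
    by apply: gP; right.
  have [Ex nPx] := XE _ _ Xx fx.
  have Cy : C y by apply: contrapT => nCy; apply: fg; rewrite gb // fb.
  have nPy : ~ P k.+1 y by move=> Py; apply: fg; rewrite (gP _ _ Py).
  have yS : y \in S k by have [/EP|] := hN k x y Cy axy Ex.
  apply/flatten_mapP; exists y => //; apply/map_f/hL.
    move=> ix; apply: (nPy); right; split=> //; last by right.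
    by move=> Py; apply: nPy; left.
  by split=> //; apply: adj_sym.
have /choice[c hc] (x : V) : exists t, (forall k, XX k x -> t = h k x) /\
    ((forall k, ~ XX k x) -> t = g x).
  case: (pselect (exists k, XX k x)) => [[k Xk]|nX].
    by exists (h k x); split=> [j Xj|/(_ k)//]; rewrite (Xdis _ _ _ Xj Xk).
  by exists (g x); split=> // k Xk; case: nX; exists k.
have cX k x : XX k x -> c x = h k x by have [h1 _] := hc x; apply: h1.
have cg x : ~ (C x /\ fin x) -> c x = g x.
  move=> nx; have [h1 h2] := hc x.
  case: (pselect (exists k, XX k x)) => [[k Xk]|nX].
    rewrite (h1 _ Xk); have [hg _] := hh k; apply: findiff_out hg _ => -[[Cx _ _] fx].
    exact: nx.
  by apply: h2 => k Xk; apply: nX; exists k.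
(* A neighbour in [C] of the earlier block lies in that block or has infinite degree. *)
have nadj' i j x y : i < j -> XX j x -> fin x -> XX i y -> fin y -> ~ adj x y.
  move=> ij Xx fx Xy fy axy; have [Cx nPx _] := Xx.
  have [Ey _] := XE _ _ Xy fy.
  have [/EP Px|/hS/(_ Cx)//] := hN i y x Cx (adj_sym axy) Ey.
  by apply: nPx; apply: Pm Px.
have nadj i j x y : XX j x -> fin x -> XX i y -> fin y -> adj x y -> i = j.
  move=> Xx fx Xy fy axy; case: (ltngtP i j) => // ij.
    by case: (nadj' i j x y ij).
  by case: (nadj' j i y x ij) => //; apply: adj_sym.
have finP x : C x -> fin x -> exists k, P k x.
  move=> Cx fx; apply: contrapT => nP; apply: (Rinf x) => //; split=> // k Pk.
  by apply: nP; exists k.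
exists c; split.
- by move=> x nC; rewrite cg ?gb // => -[].
- move=> e ec.
  (* [e] replaces [c] one stage at a time. The outside neighbours of the finite-degree vertices of a
     stage keep their colours, so no replacement raises the cut. *)
  pose hyb j x := if `[< P j x >] then e x else c x.
  have hyb_le j : eventually (fun n => cut n (hyb j) <= cut n c).
    elim: j => [|j IH].
      have -> : hyb 0 = c by apply/funext => x; rewrite /hyb asboolF.
      exact: eventually_all.
    have [hg1 hg2] := hh j.
    have sm : strong_max (XX j) (hyb j).
      apply: (strong_max_transfer hg2) => [x Xx|x y Xx fx nXy axy].
        by rewrite /hyb asboolF ?(cX j) //; case: Xx.
      rewrite (findiff_out hg1); last by case.
      have nCf : ~ (C y /\ fin y).
        move=> [Cy fy]; have [k /PX[i _ Xi]] := finP y Cy fy.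
        by have ij := nadj _ _ _ _ Xx fx Xi fy axy; subst i.
      by rewrite /hyb (findiff_out ec) // cg // if_same.
    have sub : findiff (XX j) (hyb j.+1) (hyb j).
      have [F [F1 F2]] := ec; exists [seq x <- F | `[< XX j x >]]; split=> x; rewrite mem_filter.
        by move=> /andP[/asboolP Xx /F1[]].
      case: (boolP (x \in F)) => [xF|xF _]; last by rewrite /hyb (F2 x) // !if_same.
      rewrite andbT => /asboolPn nX; rewrite /hyb.
      by congr (if _ then _ else _); apply: asbool_equiv_eq; split=> [/PS[]|] //; left.
    by apply: eventually_mono (eventually_and (sm _ sub) IH) => n []; apply: leq_trans.
  have [F [F1 F2]] := ec.
  have [n hn] : exists n, forall x, x \in F -> P n x.
    have : forall x, x \in F -> exists k, P k x by move=> x /F1[Cx fx]; apply: finP.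
    elim: (F) => [|x s IH] sP; first by exists 0.
    have [n hn] := IH (fun y ys => sP y (mem_behead (s := x :: s) ys)).
    have [k hk] := sP x (mem_head _ _); exists (maxn n k) => y.
    rewrite inE => /orP[/eqP->|/hn]; first by apply: Pm hk; apply: leq_maxr.
    by apply: Pm; apply: leq_maxl.
  suff <- : hyb n = e by apply: hyb_le.
  apply/funext => x; rewrite /hyb; case: asboolP => // nPx; apply/esym/F2.
  by apply/negP => /hn.
- move=> t Ct nf; have ct : c t = g t by apply: cg => -[].
  case: (pselect (exists k, P k t)) => [[k /PX[j _ Xj]]|nP].
    have [s hs] : exists s : seq V, forall y, P j.+1 y -> c y <> g y -> y \in s.
      elim: j.+1 => [|i [s hs]]; first by exists [::].
      have [[F [F1 F2]] _] := hh i; exists (s ++ F) => y /PS[Py|Xy] cy; rewrite mem_cat.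
        by rewrite hs.
      apply/orP; right; apply: contrapT => /negP /F2 hg; apply: cy.
      by rewrite (cX _ _ Xy).
    apply: (infinite_sub (s := s) (fo j t Xj nf)) => y [aty Yy fy].
    have tP : P j.+1 t by right.
    case: (pselect (c y = g y)) => [cy|cy]; last first.
      right; case: Yy => [[_ nCy]|Py]; last exact: hs.
      by case: cy; apply: cg => -[].
    left; split=> //; first by case: Yy => [[]//|/PC/CY].
    rewrite cy ct (gP _ _ tP); case: Yy => [[_ nCy]|Py]; first by rewrite gb // -(fb j.+1).
    by rewrite (gP _ _ Py).
  have Rt : R t by split=> // k Pk; apply: nP; exists k.
  apply: (infinite_sub (s := [::]) (g3 t Rt nf)) => y [aty [Yy hy] gy]; left.
  by split=> //; rewrite ct cg // => -[]; case: hy.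
Qed.

Lemma hgood_infinite_boundary (C : V -> Prop) (E : nat -> V -> Prop) (S : nat -> seq V) :
  (forall k, hgood (E k)) ->
  (forall k x, x \in S k -> C x -> ~ fin x) ->
  (forall k x y, C y -> adj x y -> E k x -> E k y \/ y \in S k) ->
  (forall x, C x -> (exists k, E k x) \/ ~ fin x) ->
  (forall x, C x -> (forall k, ~ E k x) ->
     exists m, forall y, C y -> adj x y -> ~ fin y \/ E m y) ->
  hgood C.
Proof.
move=> hE hS hN hC hT W WC.
apply: (@good_infinite_boundary W (fun k x => E k x /\ W x) S).
- by move=> k; apply: hgood_sub (hE k) => x [].
- by move=> k x [].
- by move=> k x xS Wx; apply: hS xS (WC _ Wx).
- by move=> k x y Wy axy [Ek Wx]; have [] := hN k x y (WC _ Wy) axy Ek; auto.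
- by move=> x Wx; have [[k Ek]|] := hC x (WC _ Wx); [left; exists k | right].
- move=> x Wx nE; have [|m hm] := hT x (WC _ Wx); first by move=> k Ek; apply: (nE k).
  by exists m => y Wy axy; have [] := hm y (WC _ Wy) axy; auto.
Qed.

(** * Bad components and alternating rays *)

Inductive comp A x : V -> Prop :=
  | comp0 : A x -> comp A x x
  | compS y z : comp A x y -> adj y z -> A z -> comp A x z.

Lemma comp_in A x y : comp A x y -> A y.
Proof. by case. Qed.

Lemma comp_src A x y : comp A x y -> A x.
Proof. by elim. Qed.

Lemma comp_trans A x y z : comp A x y -> comp A y z -> comp A x z.
Proof. by move=> xy; elim=> // u w _ xu uw Aw; apply: compS xu uw Aw. Qed.

Lemma comp_sym A x y : comp A x y -> comp A y x.
Proof.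
elim=> [Ax|u w xu ux uw Aw]; first exact: comp0.
by apply: comp_trans ux; apply: (compS (comp0 Aw)); [apply: adj_sym | apply: comp_in xu].
Qed.

Lemma comp_eq A x y : comp A x y -> comp A y = comp A x.
Proof.
move=> xy; apply/predeqP => z; split; first exact: comp_trans.
exact/comp_trans/comp_sym.
Qed.

Lemma comp_mono A C x y : (forall z, A z -> C z) -> comp A x y -> comp C x y.
Proof.
move=> AC; elim=> [/AC|u w _ xu uw /AC Cw]; first exact: comp0.
exact: compS xu uw Cw.
Qed.

Lemma hgood_empty A : (forall x, ~ A x) -> hgood A.
Proof. by move=> nA W WA; apply: good_infinite => x /WA/nA. Qed.

(** Components are blocks with empty boundary, indexed by the codes of their vertices; repetitions
    do no harm. *)
Lemma hgood_comp A : (forall x, A x -> hgood (comp A x)) -> hgood A.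
Proof.
move=> hA.
apply: (@hgood_finite_boundary _
  (fun k x => if pickle_inv k is Some v then comp A v x else False) (fun=> [::])) => //.
- move=> k; case: (pickle_inv k) => [v|]; last by apply: hgood_empty => x [].
  by case: (pselect (A v)) => [/hA//|nA]; apply: hgood_empty => x /comp_src/nA.
- by move=> k x y Ay axy; case: (pickle_inv k) => // v vx; left; apply: compS vx axy Ay.
- by move=> x Ax; left; exists (pickle x); rewrite pickleK_inv; apply: comp0.
Qed.

(** * Components whose reachable vertices are all of one kind *)

Section Stuck.
Variables (C : V -> Prop) (v : V).
Hypothesis Cv : forall x, C x -> comp C v x.

(* Paths from [v] are stored backwards, most recent vertex first. *)
Fixpoint rest s : V -> Prop :=
  if s is x :: s' then fun y => comp (rest s') x y /\ y <> x else C.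

Fixpoint bad_path s : Prop :=
  if s is y :: s' then
    if s' is x :: _ then
      [/\ bad_path s', rest s' y, adj x y & ~ hgood (comp (rest s') y)]
    else y = v
  else False.

(** These are the blocks: what is hereditarily good after deleting a path, so that the boundary in
    [C] lies on the path. *)
Definition ranked_part s x := [/\ bad_path s, rest s x & hgood (comp (rest s) x)].

Lemma rest_nbr s x y : rest s x -> C y -> adj x y -> rest s y \/ y \in s.
Proof.
elim: s x y => [|z s IH] x y /=; first by left.
move=> [zx xz] Cy axy; rewrite inE.
have [ry|->] := IH x y (comp_in zx) Cy axy; last by rewrite orbT; right.
case: eqP => [|yz]; first by right.
by left; split=> //; apply: compS zx axy ry.
Qed.

Lemma bad_path_mem s x : bad_path s -> x \in s -> exists s', bad_path (x :: s').
Proof.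
elim: s => // y s IH ps; rewrite inE => /orP[/eqP->|xs]; first by exists s.
have ps' : bad_path s by case: s ps xs {IH} => // z s [].
exact: IH ps' xs.
Qed.

Lemma ranked_part_hgood s : hgood (ranked_part s).
Proof.
apply: hgood_comp => x [ps rx hx]; apply: hgood_sub hx => y.
by apply: comp_mono => z [].
Qed.

Lemma ranked_part_nbr s x y : C y -> adj x y -> ranked_part s x ->
  ranked_part s y \/ y \in s.
Proof.
move=> Cy axy [ps rx hx]; have [ry|] := rest_nbr rx Cy axy; last by right.
left; split=> //; rewrite (comp_eq (x := x) (y := y)) //.
exact: compS (comp0 rx) axy ry.
Qed.

Hypothesis Cvv : C v.

(** If [y] lies on the path, the path is cut off at [y]. Otherwise [y] is in what remains, where a
    bad component extends the path and a good one belongs to the block. *)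
Lemma bad_path_nbr x s y : bad_path (x :: s) -> C y -> adj x y ->
  (exists s', bad_path (y :: s')) \/ ranked_part (x :: s) y.
Proof.
move=> ps Cy axy.
have rx : rest s x by case: s ps => [->|z s []].
have [ry|ys] := rest_nbr rx Cy axy; last first.
  left; have ps' : bad_path s by case: s ps ys {rx} => // z s [].
  exact: bad_path_mem ps' ys.
case: (pselect (y = x)) => [->|yx]; first by left; exists s.
have ry' : rest (x :: s) y by split=> //; apply: compS (comp0 rx) axy ry.
case: (pselect (hgood (comp (rest (x :: s)) y))) => [h|h]; first by right.
by left; exists (x :: s).
Qed.

Lemma bad_path_cover x : C x ->
  (exists s, bad_path (x :: s)) \/ exists s, ranked_part s x.
Proof.
move/Cv; elim=> [_|y z _ IH ayz Cz]; first by left; exists [::].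
case: IH => [[s ps]|[s hs]].
  by have [|h] := bad_path_nbr ps Cz ayz; [left | right; exists (y :: s)].
have [h|zs] := ranked_part_nbr Cz ayz hs; first by right; exists s.
by left; apply: bad_path_mem zs; case: hs.
Qed.

Definition block k : V -> Prop :=
  if @unpickle (seq V) k is Some s then ranked_part s else fun=> False.

(** Codes of other sequences get the empty boundary, so that boundaries consist of reachable
    vertices only. *)
Definition block_path k : seq V :=
  if @unpickle (seq V) k is Some s then if `[< bad_path s >] then s else [::] else [::].

Lemma block_pickle s : block (pickle s) = ranked_part s.
Proof. by rewrite /block pickleK. Qed.

Lemma block_hgood k : hgood (block k).
Proof.
rewrite /block; case: unpickle => [s|]; first exact: ranked_part_hgood.
by apply: hgood_empty => x [].
Qed.

Lemma block_path_mem k x : x \in block_path k -> exists s, bad_path (x :: s).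
Proof.
rewrite /block_path; case: unpickle => // s; case: asboolP => // ps.
exact: bad_path_mem.
Qed.

Lemma block_nbr k x y : C y -> adj x y -> block k x ->
  block k y \/ y \in block_path k.
Proof.
rewrite /block /block_path; case: unpickle => // s Cy axy hx.
have [ps _ _] := hx; rewrite asboolT //; exact: ranked_part_nbr hx.
Qed.

Lemma stuck_finite : (forall x s, bad_path (x :: s) -> fin x) -> hgood C.
Proof.
move=> hfin; apply: (@hgood_finite_boundary _ block block_path).
- exact: block_hgood.
- by move=> k x /block_path_mem[s /hfin].
- exact: block_nbr.
- move=> x /bad_path_cover[[s /hfin]|[s hs]]; first by right.
  by left; exists (pickle s); rewrite block_pickle.
Qed.

Lemma stuck_infinite : (forall x s, bad_path (x :: s) -> ~ fin x) -> hgood C.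
Proof.
move=> hinf; apply: (@hgood_infinite_boundary _ block block_path).
- exact: block_hgood.
- by move=> k x /block_path_mem[s /hinf].
- exact: block_nbr.
- move=> x /bad_path_cover[[s /hinf]|[s hs]]; first by right.
  by left; exists (pickle s); rewrite block_pickle.
- move=> x /bad_path_cover[[s ps]|[s hs]] nb; last first.
    by case: (nb (pickle s)); rewrite block_pickle.
  (* A neighbour of [x] that no bad path reaches lies in the block of the path ending at [x]. *)
  exists (pickle (x :: s)) => y Cy axy; rewrite block_pickle.
  by have [[s' /hinf]|] := bad_path_nbr ps Cy axy; auto.
Qed.

End Stuck.

Definition ray_step (p q : (V -> Prop) * V) :=
  [/\ adj p.2 q.2, p.1 q.2 /\ q.2 <> p.2,
      q.1 = comp (fun y => p.1 y /\ y <> p.2) q.2 & ~ hgood q.1].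

Lemma bad_path_steps C v x s : (forall y, C y -> comp C v y) ->
  bad_path C v (x :: s) -> exists n, steps ray_step n (C, v) (comp (rest C s) x, x).
Proof.
move=> Cv; elim: s x => [|y s IH] x.
  move=> ->; exists 0 => /=; congr (_, _); apply/predeqP => y; split; first exact: Cv.
  exact: comp_in.
move=> [/IH[n hn] /= rx ayx nh]; exists n.+1; apply: steps_rcons hn _.
by split.
Qed.

Lemma hgood_no_ray A : (forall r : nat -> V, injective r ->
    (forall n, adj (r n) (r n.+1)) -> (forall n, A (r n)) ->
    (forall m, exists2 n, m <= n & fin (r n)) ->
    ~ (forall m, exists2 n, m <= n & ~ fin (r n))) ->
  hgood A.
Proof.
move=> noray; apply: contrapT => nA.
have [v [Av nv]] : exists v, A v /\ ~ hgood (comp A v).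
  apply: contrapT => h; apply/nA/hgood_comp => x Ax; apply: contrapT => nx.
  by apply: h; exists x.
pose Inv (p : (V -> Prop) * V) := [/\ p.1 p.2, forall x, p.1 x -> comp p.1 p.2 x,
  ~ hgood p.1 & forall x, p.1 x -> A x].
have compC B x y : comp B x y -> comp (comp B x) x y.
  elim=> [Bx|u w xu xxu uw Bw]; first exact/comp0/comp0.
  by apply: (compS xxu uw); apply: compS xu uw Bw.
have InvS p q : Inv p -> ray_step p q -> Inv q.
{ case: p q => [C x] [D y] [/= Cx conn nC CA] [/= axy [Cy yx] -> nD]; split=> //=.
  - exact: comp0.
  - exact: compC.
  - by move=> z /comp_in[/CA]. }
pose K (p : (V -> Prop) * V) := `[< fin p.2 >].
(* If no state of kind [t] were reachable, all bad paths would consist of vertices of the other kind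
   and [C] would be hereditarily good. *)
have reach p : Inv p -> forall t, exists n q, steps ray_step n p q /\ K q = t.
  case: p => [C x] [/= Cx conn nC CA] t; apply: contrapT => h; apply: nC.
  have hK y s : bad_path C x (y :: s) -> `[< fin y >] = ~~ t.
    move=> /(bad_path_steps conn)[n hn]; case: (boolP (`[< fin y >] == t)) => [/eqP yt|].
      by case: h; exists n, (comp (rest C s) y, y).
    by case: `[< fin y >] t {h} => [] [].
  case: t h hK => h hK.
    by apply: (stuck_infinite conn Cx) => y s /hK /asboolPn.
  by apply: (stuck_finite conn Cx) => y s /hK /asboolP.
have I0 : Inv (comp A v, v).
  by split=> //=; [apply: comp0 | apply: compC | move=> x /comp_in].
have [f [f0 fS fK]] := alternating_walk InvS reach I0.
have If n : Inv (f n) by elim: n => [|n IH]; [rewrite f0 | apply: InvS IH (fS n)].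
have sub n x : (f n.+1).1 x -> (f n).1 x /\ x <> (f n).2.
  by have [_ _ -> _] := fS n; apply: comp_in.
(* Each step deletes the current vertex for good, which makes the ray injective. *)
have subm n m x : n < m -> (f m).1 x -> x <> (f n).2.
  move=> /subnK <-; elim: (m - n.+1) => [/sub[]//|k IH].
  by rewrite addSn => /sub[/IH].
have fin_ m n : m < n -> (f n).2 <> (f m).2.
  by move=> mn; apply: (subm m n) => //; have [] := If n.
apply: (noray (fun n => (f n).2)).
- move=> m n e; case: (ltngtP m n) => // /fin_; by rewrite e.
- by move=> n; have [] := fS n.
- by move=> n; have [h _ _ hA] := If n; apply: hA.
- by move=> m; have [n mn /asboolP] := fK true m; exists n.
- by move=> m; have [n mn /negbT/asboolPn] := fK false m; exists n.
Qed.

(** * Cut edges as two-element sets *)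

Definition cut_edges n c : seq {fset V} :=
  [seq [fset p.1; p.2]%fset | p <- edges n & c p.1 != c p.2].

Lemma size_cut_edges n c : size (cut_edges n c) = cut n c.
Proof.
rewrite size_map size_filter -sum1_count big_mkcond /=.
by apply: eq_bigr => p _; case: (_ != _).
Qed.

Lemma fset2_inj (x y u v : V) : [fset x; y]%fset = [fset u; v]%fset ->
  (x = u /\ y = v) \/ (x = v /\ y = u).
Proof.
move=> /fsetP E.
have := E x; have := E y; have := E u; have := E v; rewrite !in_fset2 !eqxx /= !orbT.
move=> /orP[]/eqP hv /orP[]/eqP hu /esym/orP[]/eqP hy /esym/orP[]/eqP hx;
  subst; auto.
Qed.

Lemma uniq_cut_edges n c : uniq (cut_edges n c).
Proof.
rewrite map_inj_in_uniq; first exact/filter_uniq/uniq_edges.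
move=> [x y] [u v]; rewrite mem_filter mem_edges => /andP[_ /and3P[_ xy _]].
rewrite mem_filter mem_edges => /andP[_ /and3P[_ uv _]] /= /fset2_inj[[-> ->//]|[xv yu]].
by move: xy uv; rewrite xv yu => h1 h2; have := ltn_trans h1 h2; rewrite ltnn.
Qed.

Lemma mem_cut_edges n c u v :
  adj u v -> c u <> c v -> u \in verts n -> v \in verts n ->
  [fset u; v]%fset \in cut_edges n c.
Proof.
move=> auv cuv; rewrite !mem_verts => un vn.
have uv : pickle u != pickle v.
  by apply/eqP => /(pcan_inj (@pickleK V)) e; apply: cuv; rewrite e.
case: (ltngtP (pickle u) (pickle v)) uv => // uv _; apply/mapP.
  by exists (u, v) => //; rewrite mem_filter mem_edges /= uv vn asboolT // !andbT; apply/eqP.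
exists (v, u); last by rewrite /= fsetUC.
rewrite mem_filter mem_edges /= uv un asboolT ?andbT //; last exact: adj_sym.
by rewrite eq_sym; apply/eqP.
Qed.

Lemma cut_edgesP n c (e : {fset V}) : e \in cut_edges n c ->
  trans adj c e /\ forall x, x \in e -> x \in verts n.
Proof.
move=> /mapP[[u v]]; rewrite mem_filter mem_edges => /= /andP[/eqP cuv /and3P[/asboolP auv uv vn]] ->.
split; first by exists u, v.
by move=> x; rewrite in_fset2 mem_verts => /orP[/eqP->|/eqP->] //; apply: ltn_trans uv vn.
Qed.

(** For large [n] every edge at [F] lies among the first [n] vertices, so the differences of the two
    lists of cut edges are those of [trans]; the common edges cancel. *)
Lemma strong_max_strongly_maximal A c :
  strong_max A c -> strongly_maximal_in adj c A.
Proof.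
move=> sm F hF; pose d := flip c F.
have dE x : x \notin F -> d x = c x by rewrite /d /flip => /negbTE->.
have dc : findiff A d c by exists F.
have [N1 hN1] := sm d dc.
have [N2 hN2] := verts_sub (F ++ flatten (map nbrs F)).
pose n := maxn N1 N2.
have le : cut n d <= cut n c by apply: hN1; apply: leq_maxl.
have near u v : adj u v -> u \in F -> u \in verts n /\ v \in verts n.
  move=> auv uF; split; apply: (hN2 n (leq_maxr _ _)); rewrite mem_cat ?uF //.
  apply/orP; right; apply/flatten_mapP; exists u => //.
  by apply: nbrsP => //; have [] := hF u uF.
have mem12 c1 c2 : (forall x, x \notin F -> c1 x = c2 x) -> forall e,
    (trans adj c1 e /\ ~ trans adj c2 e) <-> e \in [seq e <- cut_edges n c1 | e \notin cut_edges n c2].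
  move=> c12 e; rewrite mem_filter; split.
    move=> [[u [v [-> [auv cuv]]]] nt].
    have [un vn] : u \in verts n /\ v \in verts n.
      case: (boolP (u \in F)) => [|uF]; first exact: near.
      case: (boolP (v \in F)) => [vF|vF]; first by have [] := near v u (adj_sym auv) vF.
      by case: nt; exists u, v; rewrite -!c12.
    rewrite (mem_cut_edges auv cuv un vn) andbT; apply/negP => /cut_edgesP[t _]; exact: nt.
  move=> /andP[e2 e1]; have [t1 hv] := cut_edgesP e1; split=> //.
  move=> [u [v [eE [auv cuv]]]]; move/negP: e2; apply; rewrite eE.
  by apply: mem_cut_edges => //; apply: hv; rewrite eE in_fset2 eqxx ?orbT.
have cd x : x \notin F -> c x = d x by move=> /dE.
pose s1 := [seq e <- cut_edges n c | e \notin cut_edges n d].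
pose s2 := [seq e <- cut_edges n d | e \notin cut_edges n c].
exists (Z.of_nat (size s1) - Z.of_nat (size s2))%Z; split.
  exists (size s1), (size s2); split; last split=> //.
    exists s1; split; [exact/filter_uniq/uniq_cut_edges | split=> //; exact: mem12].
  by exists s2; split; [exact/filter_uniq/uniq_cut_edges | split=> //; exact: mem12].
have sz c1 c2 : size (cut_edges n c1) =
    size [seq e <- cut_edges n c1 | e \in cut_edges n c2] +
    size [seq e <- cut_edges n c1 | e \notin cut_edges n c2].
  by rewrite !size_filter count_predC.
have E : size [seq e <- cut_edges n c | e \in cut_edges n d] =
    size [seq e <- cut_edges n d | e \in cut_edges n c].
  apply/perm_size/uniq_perm; try exact/filter_uniq/uniq_cut_edges.
  by move=> e; rewrite !mem_filter andbC.
have := sz c d; have := sz d c; rewrite !size_cut_edges E -/s1 -/s2; lia.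
Qed.

End Graph.

(** * The graph with [K] attached *)

Lemma infinite_unfriendly (V : countType) (adj : V -> V -> Prop) c x :
  infinite (opposite adj c (fun=> True) x) -> unfriendly_at adj c x.
Proof.
move=> inf.
have /choice[nx hnx] (s : seq V) : exists y, [/\ adj x y, c y <> c x & y \notin s].
  by have [y [? _ ?] ?] := inf s; exists y.
pose l := fix l n := if n is m.+1 then nx (l m) :: l m else [::].
have lP m n : m < n -> nx (l m) \in l n.
  elim: n => // n IH; rewrite ltnS leq_eqVlt => /orP[/eqP->|/IH]; first exact: mem_head.
  by rewrite /= inE => ->; rewrite orbT.
have l_neq m n : m < n -> nx (l m) <> nx (l n).
  by move=> /lP h e; have [_ _] := hnx (l n); rewrite -e h.
(* A sequence of distinct opposite neighbours, indexed by codes, receives an injection of all of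
   [V]. *)
exists (fun y => nx (l (pickle y))); split=> [y _|y z _ _ e].
  by have [] := hnx (l (pickle y)).
apply: (pcan_inj (@pickleK V)).
by case: (ltngtP (pickle y) (pickle z)) => // /l_neq; rewrite e.
Qed.

Lemma hat_finite_degree (VG : countType) (VK : finType) (adjG : VG -> VG -> Prop)
    (adjK : VK -> VK -> Prop) (cross : VG -> VK -> Prop) a :
  finite_degree (hat_adj adjG adjK cross) (inl a) <-> finite_degree adjG a.
Proof.
split=> -[s hs].
  exists (pmap (fun x : VG + VK => if x is inl u then Some u else None) s) => u au.
  apply/InP; rewrite mem_pmap; apply/mapP; exists (inl u) => //; apply/InP.
  exact: (hs (inl u)).
exists ([seq inl u | u <- s] ++ [seq inr k | k <- enum VK]) => -[u|k] h;
  apply/InP; rewrite mem_cat; apply/orP; [left | right]; apply: map_f.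
  exact/InP/hs.
by rewrite mem_enum.
Qed.

Theorem theorem3p1
  (VG : countType) (VK : finType)
  (adjG : VG -> VG -> Prop) (adjK : VK -> VK -> Prop) (cross : VG -> VK -> Prop)
  (hG : simple_graph adjG) (hK : simple_graph adjK)
  (noray : forall r : nat -> VG, ~ alternating_ray adjG r)
  (cK : VK -> bool) :
  exists c : VG + VK -> bool,
    (forall k, c (inr k) = cK k) /\
    strongly_maximal_in (hat_adj adjG adjK cross) c
      (fun x => exists a, x = inl a) /\
    (forall a : VG, ~ finite_degree (hat_adj adjG adjK cross) (inl a) ->
       unfriendly_at (hat_adj adjG adjK cross) c (inl a)).
Proof.
pose adj := hat_adj adjG adjK cross.
have adj_sym x y : adj x y -> adj y x.
  by case: x y => [u|k] [w|l] //=; [apply: (proj1 hG) | apply: (proj1 hK)].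
pose A (x : VG + VK) := exists a, x = inl a.
have hA : hgood adj A.
{ apply: (hgood_no_ray adj_sym) => r rinj radj /choice[q rq] rfin rinf.
  have finE n : fin adj (r n) <-> finite_degree adjG (q n).
    by rewrite rq; apply: hat_finite_degree.
  (* The indices bounded below in [alternating_ray] live in [N]. *)
  have NE n : nat_of_bin (N.of_nat n) = n by lia.
  apply: (noray q); split; [|split; [|split]].
  - by move=> m n e; apply: rinj; rewrite !rq e.
  - by move=> n; have := radj n; rewrite !rq.
  - move=> m; have [n mn fn] := rfin (N.to_nat m).
    exists (N.of_nat n); split; first lia.
    by rewrite (NE n); apply/finE.
  - move=> m; have [n mn fn] := rinf (N.to_nat m).
    exists (N.of_nat n); split; first lia.
    by rewrite (NE n) => /finE. }
(* The values on [K] are prescribed; [true] on [G] is a default. *)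
pose b (x : VG + VK) := if x is inr k then cK k else true.
have [//|x _ nf|c [cb csm copp]] := @hA A (fun _ => id) b (fun=> True).
  apply: (infinite_sub (s := [::]) (infinite_degree nf)); by left.
exists c; split; [|split].
- by move=> k; rewrite cb // => -[].
- exact: strong_max_strongly_maximal.
- by move=> a nf; apply: infinite_unfriendly; apply: copp => //; exists a.
Qed.
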